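(* Let $A=(A_1,A_2,\dots,A_n)$ be an $n$-tuple of finite supports in $\mathbb{Z}^n$, and let $S$ be the set of mixed cells for $A$ lifted with the lifting function $\tau$, which introduces a slack variable $z$ and sends each $\mathbf{a}=(a_1,a_2,\dots,a_n)\in A_i$ to $\tau(\mathbf{a})=(r_{\mathbf{a}},a_2,\dots,a_n,a_1)\in\mathbb{R}^{n+1}$, where the numbers $r_{\mathbf{a}}$ are random. Let $\mathbf{v}=(\mathbf{v}_z,\mathbf{v}_{\mathbf{x}})$ be an inner normal to a mixed cell in $S$, where $\mathbf{v}_z$ is its component corresponding to $z$ and $\mathbf{v}_{\mathbf{x}}$ collects its $n$ components corresponding to the variables $\mathbf{x}$. Then $\mathbf{v}$ is a tropism (that is, $\mathbf{v}_{\mathbf{x}}$ is a tropism for the supports $A$) if and only if $\mathbf{v}_z=0$.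
   Context: The support of a polynomial $f(\mathbf{x})=\sum_{\mathbf{a}\in A}c_{\mathbf{a}}\mathbf{x}^{\mathbf{a}}$ with all $c_{\mathbf{a}}\ne0$ is $A$, and its Newton polytope is the convex hull of $A$. With $P_i=\operatorname{conv}(A_i)$, a tropism is a vector perpendicular to one edge of each $P_i$, $i=1,\dots,n$, in the inner-normal convention: the face $\partial_{\mathbf{v}}P_i=\{\mathbf{x}\in P_i : \langle\mathbf{x},\mathbf{v}\rangle=\min_{\mathbf{y}\in P_i}\langle\mathbf{y},\mathbf{v}\rangle\}$ contains an edge of $P_i$ for every $i$. The lifting $\tau$ corresponds on monomials to $\mathbf{x}^{\mathbf{a}}=x_1^{a_1}x_2^{a_2}\cdots x_n^{a_n}\mapsto z^{r_{\mathbf{a}}}x_2^{a_2}\cdots x_n^{a_n}t^{a_1}$ (so $t$ plays the role of $x_1$), where $r_{\mathbf{a}}$ is a random exponent (chosen generically, as for the usual random lifting used in mixed volume computation). The first coordinate of a lifted point corresponds to $z$; the remaining $n$ coordinates $(a_2,\dots,a_n,a_1)$ are denoted $\mathbf{a}_{\mathbf{x}}$ and correspond to the variables $x_2,\dots,x_n$ and $x_1=t$; the components of $\mathbf{v}_{\mathbf{x}}$ are ordered accordingly, and saying that $\mathbf{v}_{\mathbf{x}}$ is a tropism for $A$ refers to this identification of coordinates. Mixed cells: the facets on the lower hull of the Minkowski sum $\sum_{i=1}^n\operatorname{conv}(\tau(A_i))\subset\mathbb{R}^{n+1}$ that are spanned by one edge of each $\operatorname{conv}(\tau(A_i))$ define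 the mixed cells. The inner normal to a mixed cell is the inner normal $\mathbf{v}$ of such a facet (with positive last coordinate); it satisfies $\langle\tau(\mathbf{a}),\mathbf{v}\rangle=\langle\tau(\mathbf{b}),\mathbf{v}\rangle$ for the two points $\mathbf{a},\mathbf{b}\in A_i$ spanning the edge from each $A_i$. *)

(* Defs.v *)
From mathcomp Require Import all_boot all_order all_algebra finmap.
From mathcomp Require Import mpoly.
From mathcomp Require Import boolp classical_sets reals.

Set Implicit Arguments.
Unset Strict Implicit.
Unset Printing Implicit Defensive.

Import Order.TTheory GRing.Theory Num.Theory.

Local Open Scope classical_set_scope.
Local Open Scope ring_scope.

Section Polyhedra.
Context {R : realType}.

Definition dot m (x y : 'rV[R]_m) : R := \sum_i x 0 i * y 0 i.

Definition conv m (X : {fset 'rV[R]_m}) : set 'rV[R]_m :=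
  [set x | exists w : 'rV[R]_m -> R,
     [/\ forall p, 0 <= w p,
         \sum_(p <- X) w p = 1
       & x = \sum_(p <- X) w p *: p]].

Definition minkowski_sum m n (P : 'I_n -> set 'rV[R]_m) : set 'rV[R]_m :=
  [set x | exists2 y : 'I_n -> 'rV[R]_m,
     forall i, P i (y i) & x = \sum_i y i].

Definition face m (v : 'rV[R]_m) (P : set 'rV[R]_m) : set 'rV[R]_m :=
  [set x | P x /\ forall y, P y -> dot x v <= dot y v].

(* [F] has affine dimension [d]: the affinely independent points [x0] and
   [x0 + row i U] of [F] affinely span [F]. *)
Definition has_dim m (F : set 'rV[R]_m) (d : nat) : Prop :=
  exists (x0 : 'rV[R]_m) (U : 'M[R]_(d, m)),
    [/\ row_free U, F x0, forall i, F (x0 + row i U)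
      & forall x, F x -> (x - x0 <= U)%MS].

Definition edge m (P E : set 'rV[R]_m) : Prop :=
  has_dim E 1 /\ exists v, E = face v P.

Definition lower_normal m (Q F : set 'rV[R]_m.+1) (v : 'rV[R]_m.+1) : Prop :=
  0 < v 0 ord_max /\ F = face v Q.

(* A facet is a face of codimension one in the ambient space, so that its
   normal direction is unique; this includes [Q] itself when [Q] spans only
   a hyperplane. *)
Definition lower_facet m (Q F : set 'rV[R]_m.+1) : Prop :=
  has_dim F m /\ exists v, lower_normal Q F v.

(* A mixed cell is represented by the lower facet that defines it. *)
Definition mixed_cells n (P : 'I_n -> set 'rV[R]_(1 + n)) :
    set (set 'rV[R]_(1 + n)) :=
  [set F | lower_facet (minkowski_sum P) F /\
     exists E : 'I_n -> set 'rV[R]_(1 + n),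
       (forall i, edge (P i) (E i)) /\ F = minkowski_sum E].

Definition newton_polytope n (A : {fset 'rV[int]_n}) : set 'rV[R]_n :=
  conv [fset map_mx intr a | a : 'rV[int]_n in A]%fset.

Definition tropism n (A : 'I_n -> {fset 'rV[int]_n}) (v : 'rV[R]_n) : Prop :=
  forall i, exists E : set 'rV[R]_n,
    edge (newton_polytope (A i)) E /\ E `<=` face v (newton_polytope (A i)).

(* [tau r (a_1, ..., a_n) = (r a, a_2, ..., a_n, a_1)]; [ordS] is the cyclic
   successor on ['I_n]. *)
Definition tau n (r : 'rV[int]_n -> R) (a : 'rV[int]_n) : 'rV[R]_(1 + n) :=
  row_mx (r a)%:M (\row_j (a 0 (ordS j))%:~R).

(* The random exponent of [a] in [A i] is indexed by [(c i, a)]: a constant [c]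
   attaches one number to each point, even if it belongs to several supports,
   while an injective [c] lifts the supports independently. *)
Definition lift_indices n (c : 'I_n -> 'I_n) (A : 'I_n -> {fset 'rV[int]_n}) :
    {fset 'I_n * 'rV[int]_n} :=
  (\big[fsetU/fset0]_(i < n) [fset (c i, a) | a : 'rV[int]_n in A i])%fset.

Definition lift_support n (r : 'rV[int]_n -> R) (A : {fset 'rV[int]_n}) :
    {fset 'rV[R]_(1 + n)} :=
  [fset tau r a | a : 'rV[int]_n in A]%fset.

Definition z_part n (v : 'rV[R]_(1 + n)) : R := lsubmx v 0 0.

(* The components of [v] on the variables x_2, ..., x_n, x_1 (in this order),
   put back in the order x_1, ..., x_n of the coordinates of the supports. *)
Definition x_part n (v : 'rV[R]_(1 + n)) : 'rV[R]_n :=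
  \row_j rsubmx v 0 (ord_pred j).

(* [P r] holds for generic values of [r] on the finite set [X]: it holds off
   the zero set of some nonzero polynomial in these values. *)
Definition generically (K : choiceType) (X : {fset K}) (P : (K -> R) -> Prop) :
    Prop :=
  exists2 g : {mpoly R[#|{: X}|]}, g != 0 &
    forall r : K -> R, g.@[fun j => r (val (enum_val j))] != 0 -> P r.

End Polyhedra.

(* Main.v *)
Require Import Defs.
From mathcomp Require Import all_boot all_order all_algebra finmap.
From mathcomp Require Import mpoly.
From mathcomp Require Import boolp classical_sets reals.
From mathcomp Require Import lra.

Set Implicit Arguments.
Unset Strict Implicit.
Unset Printing Implicit Defensive.

Import Order.TTheory GRing.Theory Num.Theory.

Local Open Scope ring_scope.

(** Let [F = E_1 + ... + E_n] be the facet of a mixed cell, with inner normal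
    [v]. Each [E_i] is an edge of the lifted polytope and lies in its face in
    the direction [v] ([minkowski_summand_face]); it joins two lifted points
    [p_i] and [q_i] of the [i]-th support. Since [F] has dimension [n], the
    [n] vectors [p_i - q_i] are linearly independent
    ([mixed_cell_edge_directions]).

    If [v_z = 0], then [v] takes the same value on a lifted point as [v_x] on
    the point below it. The two ends of [E_i] lie above two distinct points of
    the support, so the face of the Newton polytope in the direction [v_x] is
    not a single point, and it contains an edge ([face_contains_edge]).

    Conversely, let [v_x] be a tropism. The face of the first Newton polytope in
    the direction [v_x] contains two distinct support points [a] and [b]. Let [M] be
    the matrix whose rows are the differences [p_i - q_i] with the lifted
    coordinate dropped. Modulo the line spanned by [a - b], the [n] rows of [M]
    live in a space of dimension [n - 1], so some nonzero row vector [c] makes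
    [c M] a multiple of [a - b] ([row_relation]), whence [<c M, v_x> = 0]. As
    [<p_i - q_i, v> = 0] for all [i], this gives
    [v_z * \sum_i c_i (r_{p_i} - r_{q_i}) = 0]. The vector [c] depends only on
    the points [p_i], [q_i], [a], [b] of the supports, never on the exponents
    [r], so [\sum_i c_i (r_{p_i} - r_{q_i})] is one of finitely many linear
    forms in [r] ([edge_form]), and generic exponents annihilate none of the
    nonzero ones. It remains to see that the form at hand is nonzero
    ([edge_form_neq0]): if it vanished identically, then
    [\sum_i c_i (f(p_i) - f(q_i)) = 0] for every function [f] of the support
    points, in particular for each coordinate of the lifted points; this is a
    linear relation between the independent vectors [p_i - q_i]. Hence
    [v_z = 0]. *)

(** * The scalar product *)

Section Dot.
Context {R : realType} {m : nat}.
Implicit Types x y v : 'rV[R]_m.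

Lemma dotC x y : dot x y = dot y x.
Proof. by apply: eq_bigr => i _; rewrite mulrC. Qed.

Lemma dotDl x y v : dot (x + y) v = dot x v + dot y v.
Proof. by rewrite -big_split; apply: eq_bigr => i _; rewrite mxE mulrDl. Qed.

Lemma dotZl k x v : dot (k *: x) v = k * dot x v.
Proof. by rewrite mulr_sumr; apply: eq_bigr => i _; rewrite mxE mulrA. Qed.

Lemma dotBl x y v : dot (x - y) v = dot x v - dot y v.
Proof. by rewrite dotDl -scaleN1r dotZl mulN1r. Qed.

Lemma dotDr x v w : dot x (v + w) = dot x v + dot x w.
Proof. by rewrite dotC dotDl !(dotC x). Qed.

Lemma dotZr k x v : dot x (k *: v) = k * dot x v.
Proof. by rewrite dotC dotZl (dotC x). Qed.

Lemma dotBr x v w : dot x (v - w) = dot x v - dot x w.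
Proof. by rewrite dotC dotBl !(dotC x). Qed.

Lemma dot_suml (I : Type) (s : seq I) (P : pred I) (F : I -> 'rV[R]_m) v :
  dot (\sum_(i <- s | P i) F i) v = \sum_(i <- s | P i) dot (F i) v.
Proof.
apply: (big_morph (fun x => dot x v)) => [x y|]; first exact: dotDl.
by rewrite -(scale0r 0) dotZl mul0r.
Qed.

Lemma dot_gt0 x : x != 0 -> 0 < dot x x.
Proof.
have ge0 i : 0 <= x 0 i * x 0 i by rewrite -expr2 sqr_ge0.
move=> xn0; rewrite lt_neqAle sumr_ge0 // andbT.
apply: contra xn0; rewrite eq_sym psumr_eq0 // => /allP x0.
apply/eqP/rowP => i; rewrite mxE; apply/eqP.
by have := x0 i (mem_index_enum _); rewrite /= mulf_eq0 orbb.
Qed.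

End Dot.

(** * Extrema over finite sets *)

Section FiniteSets.
Context {R : realType}.

Lemma seq_argmin (T : eqType) (f : T -> R) (s : seq T) x : x \in s ->
  exists2 y, y \in s & forall z, z \in s -> f y <= f z.
Proof.
elim: s x => // a [|b s] IH x _.
  by exists a => [|z]; rewrite !inE // => /eqP ->.
have [y ys ymin] := IH b (mem_head _ _).
have [ay|/ltW ya] := leP (f a) (f y).
  exists a => [|z]; first exact: mem_head.
  by rewrite in_cons => /predU1P[->//|/ymin]; exact: le_trans.
exists y => [|z]; first by rewrite in_cons ys orbT.
by rewrite in_cons => /predU1P[->//|/ymin].
Qed.

(** This fixes how far a functional may be perturbed without reversing any of
    finitely many strict inequalities. *)
Lemma small_multiplier (T : eqType) (f g : T -> R) (s : seq T) :
  exists2 e, 0 < e & forall z, z \in s -> 0 < f z -> e * g z < f z.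
Proof.
elim: s => [|a s [e e0 IH]]; first by exists 1.
have [fa|fa] := leP (f a) 0.
  exists e => // z; rewrite in_cons => /predU1P[->|]; last exact: IH.
  by rewrite ltNge fa.
pose d := f a / (1 + `|g a|).
have g1 : 0 < 1 + `|g a| by rewrite ltr_pwDl.
have d0 : 0 < d by rewrite divr_gt0.
have de0 : 0 < Num.min d e by rewrite lt_min d0.
exists (Num.min d e) => // z; rewrite in_cons => /predU1P[->|zs] fz.
  apply: (@le_lt_trans _ _ (Num.min d e * `|g a|)).
    by rewrite ler_pM2l // ler_norm.
  apply: (@le_lt_trans _ _ (d * `|g a|)); first by rewrite ler_wpM2r // ge_min lexx.
  by rewrite /d -mulrA gtr_pMr // mulrC ltr_pdivrMr // mul1r ltrDr.
have [g0|g0] := leP (g z) 0.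
  by apply: le_lt_trans fz; rewrite pmulr_rle0.
by apply: le_lt_trans (IH z zs fz); rewrite ler_pM2r // ge_min lexx orbT.
Qed.

End FiniteSets.

(** * Faces of the convex hull of a finite set *)

Lemma has_dim1_points (R : realType) m (F : set 'rV[R]_m) :
  has_dim F 1 -> exists x y, [/\ F x, F y & x != y].
Proof.
move=> [x [u [ufree Fx Fxu _]]]; exists x, (x + row ord0 u); split=> //.
rewrite -subr_eq0 opprD addrA subrr sub0r oppr_eq0 row_id.
by move: ufree; rewrite /row_free rank_rV; case: (u == 0).
Qed.

Section Faces.
Context {R : realType} {m : nat}.
Implicit Types (X Y : {fset 'rV[R]_m}) (p q x v w : 'rV[R]_m).

Lemma sub_conv X p : p \in X -> conv X p.
Proof.
move=> pX; exists (fun q => (q == p)%:R); split=> [q||]; first exact: ler0n.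
  rewrite (bigD1_seq p) ?fset_uniq //= eqxx big1 ?addr0 // => q /negPf ->.
  by [].
rewrite (bigD1_seq p) ?fset_uniq //= eqxx scale1r big1 ?addr0 // => q /negPf ->.
by rewrite scale0r.
Qed.

Lemma face_convP X v p : p \in X ->
  face v (conv X) p <-> forall q, q \in X -> dot p v <= dot q v.
Proof.
move=> pX; split=> [[_ pmin] q qX|pmin]; first exact/pmin/sub_conv.
split=> [|_ [w [w0 w1 ->]]]; first exact: sub_conv.
rewrite dot_suml -[dot p v]mul1r -w1 mulr_suml big_seq [leRHS]big_seq.
by apply: ler_sum => q qX; rewrite dotZl ler_wpM2l // pmin.
Qed.

Lemma face_conv_eq X v p q : face v (conv X) p -> face v (conv X) q ->
  dot p v = dot q v.
Proof. by move=> [Xp pm] [Xq qm]; apply: le_anti; rewrite pm // qm. Qed.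

(** The mean of [dot p v] with the weights of [x] is the minimum over the hull,
    so every point of positive weight attains this minimum. *)
Lemma face_weights X v x : face v (conv X) x ->
  exists w : 'rV[R]_m -> R, [/\ forall p, 0 <= w p, \sum_(p <- X) w p = 1,
    x = \sum_(p <- X) w p *: p &
    forall p, p \in X -> w p != 0 -> face v (conv X) p].
Proof.
move=> [[w [w0 w1 xE]] xmin]; exists w; split=> // p pX wp.
have ge0 q : q \in X -> 0 <= w q * (dot q v - dot x v).
  by move=> qX; rewrite mulr_ge0 // subr_ge0; exact/xmin/sub_conv.
have sum0 : \sum_(q <- X | q \in X) w q * (dot q v - dot x v) == 0.
  rewrite -big_seq (eq_bigr (fun q => dot (w q *: q) v - w q * dot x v)).
    by rewrite sumrB -dot_suml -xE -mulr_suml w1 mul1r subrr.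
  by move=> q _; rewrite mulrBr dotZl.
move: sum0; rewrite psumr_eq0 // => /allP/(_ p pX).
rewrite pX mulf_eq0 (negPf wp) subr_eq0 => /eqP pxv.
by split=> [|y /xmin]; [exact: sub_conv | rewrite pxv].
Qed.

Lemma face_two_vertices X v x y :
  face v (conv X) x -> face v (conv X) y -> x != y ->
  exists p q, [/\ p \in X, q \in X, p != q,
    face v (conv X) p & face v (conv X) q].
Proof.
move=> Fx Fy xy; apply: contrapT => noq.
have same p q : p \in X -> q \in X -> face v (conv X) p -> face v (conv X) q ->
    p = q.
  by move=> pX qX Fp Fq; apply: contrapT => /eqP pq; apply: noq; exists p, q.
have eqp p z : p \in X -> face v (conv X) p -> face v (conv X) z -> z = p.
  move=> pX Fp /face_weights[w [_ w1 -> wF]].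
  rewrite -[RHS]scale1r -w1 scaler_suml big_seq [RHS]big_seq.
  apply: eq_bigr => q qX; have [->|wq] := eqVneq (w q) 0; first by rewrite !scale0r.
  by rewrite (same q p) //; exact: wF.
have [w [_ w1 _ wF]] := face_weights Fx.
have [p pX Fp] : exists2 p, p \in X & face v (conv X) p.
  apply: contrapT => noF; move/eqP: w1; rewrite big_seq big1 ?(eq_sym 0) ?oner_eq0 //.
  move=> p pX; apply/eqP; apply: contrapT => /negP wp; apply: noF.
  by exists p => //; exact: wF.
by move/eqP: xy; apply; rewrite (eqp p x) // (eqp p y).
Qed.

(** A face of a face is exposed in the whole polytope: for small [e > 0], the
    vector [v + e *: w] compares points by [v] first and breaks ties by [w]. *)
Lemma face_perturb X v w p0 : p0 \in X -> face v (conv X) p0 ->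
  exists e, forall p, p \in X -> face (v + e *: w) (conv X) p <->
    face v (conv X) p /\
    forall q, q \in X -> face v (conv X) q -> dot p w <= dot q w.
Proof.
move=> p0X Fp0.
have [e e0 eP] := small_multiplier (fun z => dot z.2 v - dot z.1 v)
  (fun z => dot z.1 w - dot z.2 w) [seq (p, q) | p <- X, q <- X].
have {}eP p q : p \in X -> q \in X -> dot p v < dot q v ->
    dot p (v + e *: w) < dot q (v + e *: w).
  move=> pX qX pq; have := eP (p, q); rewrite allpairs_f // subr_gt0.
  move=> /(_ isT pq) /=; rewrite !dotDr !dotZr; lra.
exists e => p pX; rewrite face_convP //; split=> [pmin|[Fp pmin] q qX].
  have Fp : face v (conv X) p.
    apply/face_convP => // q qX.
    apply: (@le_trans _ _ (dot p0 v)); last exact: (face_convP v p0X).1.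
    by rewrite leNgt; apply/negP => /(eP _ _ p0X pX); rewrite ltNge pmin.
  split=> // q qX Fq; have := pmin q qX.
  by rewrite !dotDr !dotZr (face_conv_eq Fp Fq) lerD2l ler_pM2l.
have := (face_convP v pX).1 Fp q qX; rewrite le_eqVlt => /predU1P[pq|/eP].
  have Fq : face v (conv X) q.
    by apply/face_convP => // z zX; rewrite -pq; exact: (face_convP v pX).1.
  by rewrite !dotDr !dotZr pq lerD2l ler_pM2l // pmin.
by move=> /(_ pX qX)/ltW.
Qed.

(** A finite set [Y] that is not contained in a line has a proper exposed face
    with at least two points, here [p] and [q], while [s] is outside it. Start
    from a functional [w] that is not constant on [Y]. If it is minimal at one
    point [y0] only, tilt it around [y0], as in gift wrapping, until a second
    point becomes minimal; tilting towards a functional that is not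
    proportional to [w] on [Y - y0] keeps the minimal face proper. *)
Lemma noncollinear_functional Y p0 q0 :
  p0 \in Y -> q0 \in Y -> p0 != q0 ->
  (forall p q, p \in Y -> q \in Y -> p != q ->
     exists2 s, s \in Y & ~~ (s - p <= q - p)%MS) ->
  exists w p q s, [/\ [/\ p \in Y, q \in Y & s \in Y], p != q,
    forall y, y \in Y -> dot p w <= dot y w, dot q w = dot p w &
    dot p w < dot s w].
Proof.
move=> pY qY pq Y2.
pose w := q0 - p0.
have pw : dot p0 w < dot q0 w.
  by rewrite -subr_gt0 -dotBl dot_gt0 // subr_eq0 eq_sym.
have [y0 y0Y y0min] := seq_argmin (fun y => dot y w) pY.
have y0w : dot y0 w < dot q0 w by apply: le_lt_trans pw; exact: y0min.
have [[y1 [y1Y y1w y01]]|uniq0] :=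
    pselect (exists y1, [/\ y1 \in Y, dot y1 w = dot y0 w & y0 != y1]).
  by exists w, y0, y1, q0; split.
have {uniq0 y0min} y0lt y : y \in Y -> y != y0 -> 0 < dot (y - y0) w.
  move=> yY yy0; rewrite dotBl subr_gt0 lt_neqAle y0min // andbT.
  apply/eqP => yw; apply: uniq0; exists y; split=> //.
  by rewrite eq_sym.
have qy0 : q0 != y0 by apply: contraTneq y0w => ->; rewrite ltxx.
have y0q : y0 != q0 by rewrite eq_sym.
have [y2 y2Y y2nc] := Y2 y0 q0 y0Y qY y0q.
have y20 : y2 != y0 by apply: contraNneq y2nc => ->; rewrite subrr sub0mx.
pose a := q0 - y0; pose b := y2 - y0.
have aa0 : 0 < dot a a by rewrite dot_gt0 // subr_eq0.
(* [u] is the component of [b] orthogonal to [a]; as it vanishes at [a] and is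
   positive at [b], it is not proportional to [w]. *)
pose u := b - (dot b a / dot a a) *: a.
have au : dot a u = 0.
  by rewrite dotBr dotZr divfK ?gt_eqF // (dotC a) subrr.
have bu : 0 < dot b u.
  have -> : dot b u = dot u u by rewrite [in RHS]dotBl dotZl au mulr0 subr0.
  apply: dot_gt0; apply: contra y2nc; rewrite subr_eq0 -/b => /eqP ->.
  exact: scalemx_sub.
(* The smallest slope is where the pencil [u - k *: w] first meets a second point. *)
pose ratio y := dot (y - y0) u / dot (y - y0) w.
have [y1 y1Y ymin] : exists2 y, y \in [seq y <- Y | y != y0] &
    forall z, z \in [seq y <- Y | y != y0] -> ratio y <= ratio z.
  by apply: (@seq_argmin _ _ _ _ q0); rewrite mem_filter qy0.
move: y1Y; rewrite mem_filter => /andP[y10 y1Y].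
have {}ymin y : y \in Y -> y != y0 -> ratio y1 * dot (y - y0) w <= dot (y - y0) u.
  move=> yY yy0; rewrite -ler_pdivlMr ?y0lt //; apply: ymin.
  by rewrite mem_filter yy0.
(* The slope at [q0] is zero and the slope at [y2] is positive, so [y2] stays out. *)
have ratio_le0 : ratio y1 <= 0.
  by have := ymin q0 qY qy0; rewrite -/a au pmulr_lle0 // y0lt.
have diff y : dot y (u - ratio y1 *: w) - dot y0 (u - ratio y1 *: w) =
    dot (y - y0) u - ratio y1 * dot (y - y0) w.
  by rewrite -dotBl dotBr dotZr.
exists (u - ratio y1 *: w), y0, y1, y2; split=> //.
- by rewrite eq_sym.
- move=> y yY; rewrite -subr_ge0 diff subr_ge0.
  have [->|yy0] := eqVneq y y0; last exact: ymin.
  by rewrite subrr -(scale0r 0) !dotZl !mul0r mulr0.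
- by apply/eqP; rewrite -subr_eq0 diff /ratio divfK ?subrr // gt_eqF // y0lt.
- rewrite -subr_gt0 diff subr_gt0; apply: le_lt_trans bu.
  by rewrite mulr_le0_ge0 // ltW // y0lt.
Qed.

Lemma has_dim1_face X v p q : p \in X -> q \in X -> p != q ->
  face v (conv X) p -> face v (conv X) q ->
  (forall s, s \in X -> face v (conv X) s -> (s - p <= q - p)%MS) ->
  has_dim (face v (conv X)) 1.
Proof.
move=> pX qX pq Fp Fq col; exists p, (q - p); split=> //.
- by rewrite /row_free rank_rV subr_eq0 (eq_sym q) pq.
- by move=> i; rewrite (ord1 i) row_id addrC subrK.
move=> x /face_weights[w [_ w1 -> wF]].
have -> : \sum_(s <- X) w s *: s - p = \sum_(s <- X | s \in X) w s *: (s - p).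
  rewrite -big_seq [RHS](eq_bigr (fun s => w s *: s - w s *: p)).
    by rewrite sumrB -scaler_suml w1 scale1r.
  by move=> s _; rewrite scalerBr.
apply: summx_sub => s sX; have [->|ws] := eqVneq (w s) 0.
  by rewrite scale0r sub0mx.
by apply: scalemx_sub; apply: col => //; exact: wF.
Qed.

Lemma sub_face_conv X v v' :
  (forall p, p \in X -> face v' (conv X) p -> face v (conv X) p) ->
  (face v' (conv X) `<=` face v (conv X))%classic.
Proof.
move=> sub x F'x; have [w [w0 w1 xE wF]] := face_weights F'x.
split=> [|y Xy]; first by case: F'x.
rewrite xE dot_suml -[leRHS]mul1r -w1 mulr_suml big_seq [leRHS]big_seq.
apply: ler_sum => p pX; have [->|wp] := eqVneq (w p) 0.
  by rewrite scale0r -(scale0r 0) dotZl !mul0r.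
rewrite dotZl; apply: ler_wpM2l; first exact: w0.
by have [_] := sub p pX (wF p pX wp); exact.
Qed.

(** Induction on the number of points of [X] in the face. If they are collinear
    the face is an edge; otherwise it has a proper face with two points, which
    is again a face of [conv X] by [face_perturb]. *)
Theorem face_contains_edge X v p q : p \in X -> q \in X -> p != q ->
  face v (conv X) p -> face v (conv X) q ->
  exists E, edge (conv X) E /\ (E `<=` face v (conv X))%classic.
Proof.
pose V v := [fset s in X | `[< face v (conv X) s >]]%fset.
have inV v' s : s \in V v' <-> s \in X /\ face v' (conv X) s.
  by rewrite !inE; split=> [/andP[? /asboolP]|[-> /asboolP ->]].
have [k] := ubnP #|` V v|; elim: k => // k IH in v p q *.
rewrite ltnS => Vk pX qX pq Fp Fq.
have [[p1 [q1 [p1V q1V p1q1 col]]]|noncol] := pselect (exists p q,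
    [/\ p \in V v, q \in V v, p != q &
       forall s, s \in V v -> (s - p <= q - p)%MS]).
  exists (face v (conv X)); split=> //; split; last by exists v.
  have [[p1X Fp1] [q1X Fq1]] := ((inV _ _).1 p1V, (inV _ _).1 q1V).
  by apply: (has_dim1_face p1X q1X) => // s sX Fs; apply/col/inV.
have [||//||w [p1 [q1 [s [[p1V q1V sV] pq1 p1min q1w sw]]]]] :=
    @noncollinear_functional (V v) p q.
- exact/inV.
- exact/inV.
- move=> p1 q1 p1V q1V pq1; apply: contrapT => nos; apply: noncol.
  exists p1, q1; split=> // s sV; apply: contrapT => /negP sn.
  by apply: nos; exists s.
have [[p1X Fp1] [q1X Fq1]] := ((inV _ _).1 p1V, (inV _ _).1 q1V).
have [sX Fs] := (inV _ _).1 sV.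
have [e eP] := face_perturb w p1X Fp1.
have F1 : face (v + e *: w) (conv X) p1.
  by apply/eP => //; split=> // y yX Fy; apply/p1min/inV.
have F2 : face (v + e *: w) (conv X) q1.
  by apply/eP => //; split=> // y yX Fy; rewrite q1w; apply/p1min/inV.
have [] := IH (v + e *: w) p1 q1 _ p1X q1X pq1 F1 F2.
  apply: leq_trans Vk; apply: fproper_ltn_card; rewrite fproperE; apply/andP; split.
    by apply/fsubsetP => y /inV[yX /eP[]// Fy _]; apply/inV.
  apply/fsubsetPn; exists s => //.
  by apply/negP => /inV[_ /eP[]// _ /(_ p1 p1X Fp1)]; rewrite leNgt sw.
move=> E [EE EF]; exists E; split=> //.
apply: subset_trans EF _; apply: sub_face_conv => y yX.
by move=> /eP[].
Qed.

End Faces.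

(** * Faces of Minkowski sums *)

Section Summands.
Context {R : realType} {m n : nat}.
Implicit Types (P E : 'I_n -> set 'rV[R]_m) (v : 'rV[R]_m).

(** A linear functional on a sum of independent choices is minimal only if it is
    minimal in each of them: exchanging one summand of a minimal sum cannot
    decrease the value. *)
Lemma minkowski_summand_face P E v :
  (forall i, (E i `<=` P i)%classic) -> (forall i, exists x, E i x) ->
  minkowski_sum E = face v (minkowski_sum P) ->
  forall i, (E i `<=` face v (P i))%classic.
Proof.
move=> EP /choice[e Ee] EF i y Ey; split=> [|z Pz]; first exact: EP.
pose upd x j := if j == i then x else e j.
have sum_upd x : \sum_j upd x j = x + \sum_(j | j != i) e j.
  rewrite (bigD1 i) //= /upd eqxx; congr (_ + _).
  by apply: eq_bigr => j /negPf ->.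
have [_] : face v (minkowski_sum P) (\sum_j upd y j).
  rewrite -EF; exists (upd y) => // j.
  by rewrite /upd; have [->|] := eqVneq j i.
move=> /(_ (\sum_j upd z j)); rewrite !sum_upd !dotDl lerD2r; apply.
exists (upd z); last by rewrite sum_upd.
by move=> j; rewrite /upd; have [->//|_] := eqVneq j i; exact: EP.
Qed.

Lemma has_dim1_sub (E : set 'rV[R]_m) p q x y : has_dim E 1 ->
  E p -> E q -> p != q -> E x -> E y -> (x - y <= p - q)%MS.
Proof.
move=> [x0 [u [_ _ _ Eu]]] Ep Eq pq Ex Ey.
have Euu a b : E a -> E b -> exists k, a - b = k *: u.
  move=> /Eu ua /Eu ub; apply/sub_rVP.
  have -> : a - b = (a - x0) - (b - x0) by rewrite opprB addrA subrK.
  by apply: addmx_sub; rewrite ?eqmx_opp.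
have [[k kE] [l lE]] := (Euu p q Ep Eq, Euu x y Ex Ey).
have k0 : k != 0.
  by apply: contra_neq pq => k0; apply/subr0_eq; rewrite kE k0 scale0r.
by apply/sub_rVP; exists (l / k); rewrite kE lE scalerA divfK.
Qed.

(** The differences of points of [\sum_i E i] lie in the span of the [n] edge
    directions, and they span a space of dimension [n]. *)
Lemma mixed_cell_edge_directions (X : 'I_n -> {fset 'rV[R]_m}) E :
  (forall i, edge (conv (X i)) (E i)) -> has_dim (minkowski_sum E) n ->
  exists p q : 'I_n -> 'rV[R]_m,
    (forall i, [/\ p i \in X i, q i \in X i, E i (p i) & E i (q i)]) /\
    row_free (\matrix_i (p i - q i)).
Proof.
move=> Eedge [x0 [U [Ufree [y0 Ey0 x0E] UE _]]].
have ends i : exists pq : 'rV[R]_m * 'rV[R]_m, [/\ pq.1 \in X i, pq.2 \in X i,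
    pq.1 != pq.2, E i pq.1 & E i pq.2].
  have [/has_dim1_points[x [y [Ex Ey xy]]] [w Ew]] := Eedge i.
  rewrite Ew in Ex Ey; have [p [q [pX qX pq Fp Fq]]] := face_two_vertices Ex Ey xy.
  by exists (p, q); rewrite Ew.
have [pq pqE] := choice ends.
exists (fun i => (pq i).1), (fun i => (pq i).2); split.
  by move=> i; have [] := pqE i.
set D := \matrix_i _.
suff UD : (U <= D)%MS.
  by rewrite /row_free eqn_leq rank_leq_row -{1}(eqP Ufree) mxrankS.
apply/row_subP => j; have [y Ey yE] := UE j.
have -> : row j U = \sum_i (y i - y0 i) by rewrite sumrB -yE -x0E addrC addKr.
apply: summx_sub => i _; have [_ _ pqi Ep Eq] := pqE i.
apply: submx_trans (has_dim1_sub (Eedge i).1 Ep Eq pqi (Ey i) (Ey0 i)) _.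
by rewrite -[X in (X <= _)%MS](rowK (fun i => (pq i).1 - (pq i).2)) row_sub.
Qed.

End Summands.

(** * Generic exponents satisfy no prescribed linear relation *)

Section Relations.
Context {R : realType}.

(** Coefficients that combine the rows of [M] to a multiple of [d]: a row vector
    annihilating [M] on the hyperplane orthogonal to [d], whose basis is formed
    by columns of [cokermx d]. It is a function of [M] and [d], so that the
    coefficients are settled before the exponents are chosen. *)
Definition row_relation n (M : 'M[R]_n) (d : 'rV[R]_n) : 'rV[R]_n :=
  nz_row (kermx (M *m cokermx d)).

Lemma row_relation_sub n (M : 'M[R]_n) (d : 'rV[R]_n) : (row_relation M d *m M <= d)%MS.
Proof. by rewrite submxE -mulmxA -sub_kermx nz_row_sub. Qed.

(** The hyperplane has dimension [n - 1], so [M] restricted to it has dependent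
    rows. *)
Lemma row_relation_neq0 n (M : 'M[R]_n) (d : 'rV[R]_n) : d != 0 -> row_relation M d != 0.
Proof.
move=> d0; rewrite nz_row_eq0 kermx_eq0 /row_free neq_ltn.
have d1 : \rank d = 1%N by rewrite rank_rV d0.
have n0 : (0 < n)%N by rewrite -d1 rank_leq_col.
apply/orP; left; apply: leq_ltn_trans (mxrankM_maxr _ _) _.
by rewrite mxrank_coker d1 subn1 prednK.
Qed.

(** A property that can fail only where one of finitely many nonzero polynomials
    vanishes holds off the zero set of their product. *)
Lemma generically_finite (K : choiceType) (X : {fset K}) (I : finType)
    (L : I -> {mpoly R[#|{: X}|]}) (P : (K -> R) -> Prop) :
  (forall r : K -> R,
     (forall i, (L i).@[fun j => r (val (enum_val j))] = 0 -> L i = 0) -> P r) ->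
  generically X P.
Proof.
move=> LP; exists (\prod_(i | L i != 0) L i); first by apply/prodf_neq0.
move=> r; rewrite rmorph_prod /= => /prodf_neq0 r0.
apply: LP => i Li; apply: contrapT => /eqP L0.
by have := r0 i L0; rewrite Li eqxx.
Qed.

Variables (n : nat) (X : {fset 'I_n * 'rV[int]_n}).
Implicit Types (s a b : X) (r : 'I_n * 'rV[int]_n -> R).

Definition support_point s : 'rV[R]_n := map_mx intr (val s).2.

Definition lift_point r s : 'rV[R]_(1 + n) :=
  tau (fun a : 'rV[int]_n => r ((val s).1, a)) (val s).2.

Definition edge_relation (p q : 'I_n -> X) a b : 'rV[R]_n :=
  row_relation (\matrix_i (support_point (p i) - support_point (q i)))
    (support_point a - support_point b).

(** The variables stand for the exponents, so this is
    [\sum_i c_i (r_{p_i} - r_{q_i})] as a form in all exponents. *)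
Definition edge_form (p q : 'I_n -> X) a b : {mpoly R[#|{: X}|]} :=
  \sum_i edge_relation p q a b 0 i *: ('X_(enum_rank (p i)) - 'X_(enum_rank (q i))).

(** The values [f] need not be exponents: taking coordinates of the lifted
    points for [f] extracts vector identities from an identity of forms. *)
Lemma edge_form_eval (p q : 'I_n -> X) a b (f : X -> R) :
  (edge_form p q a b).@[fun j => f (enum_val j)] =
  \sum_i edge_relation p q a b 0 i * (f (p i) - f (q i)).
Proof.
rewrite rmorph_sum; apply: eq_bigr => i _.
by rewrite /= mevalZ mevalB !mevalXU !enum_rankK.
Qed.

Lemma dot_tau (h : 'rV[int]_n -> R) (a : 'rV[int]_n) (v : 'rV[R]_(1 + n)) :
  dot (tau h a) v = h a * z_part v + dot (map_mx intr a) (x_part v).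
Proof.
rewrite {1}/dot big_split_ord big_ord1 row_mxEl /z_part !mxE eqxx mulr1n.
congr (_ + _); rewrite /dot (reindex_inj (can_inj (@ord_predK n))) /=.
by apply: eq_bigr => j _; rewrite row_mxEr !mxE ord_predK.
Qed.

(** Summing the equations [(r_{p_i} - r_{q_i}) v_z + <p_i - q_i, v_x> = 0] with
    the coefficients [c_i] leaves [v_z] times the form, because [c M] is a
    multiple of [a - b]. *)
Lemma edge_form_eq0 (p q : 'I_n -> X) a b r (v : 'rV[R]_(1 + n)) :
  z_part v != 0 ->
  (forall i, dot (lift_point r (p i)) v = dot (lift_point r (q i)) v) ->
  dot (support_point a) (x_part v) = dot (support_point b) (x_part v) ->
  (edge_form p q a b).@[fun j => r (val (enum_val j))] = 0.
Proof.
move=> vz pqv abv; rewrite (edge_form_eval p q a b (fun s => r (val s))).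
set c := edge_relation p q a b.
apply: (mulIf vz); rewrite mul0r mulr_suml.
pose M := \matrix_i (support_point (p i) - support_point (q i)).
have : dot (c *m M) (x_part v) = 0.
  have /sub_rVP[k ->] : (c *m M <= support_point a - support_point b)%MS.
    exact: row_relation_sub.
  by rewrite dotZl dotBl abv subrr mulr0.
rewrite mulmx_sum_row dot_suml => /eqP; rewrite -oppr_eq0 -sumrN => /eqP sum0.
rewrite -[RHS]sum0.
apply: eq_bigr => i _; rewrite rowK dotZl dotBl -mulrA -mulrN; congr (_ * _).
have := pqv i; rewrite !dot_tau -!surjective_pairing /support_point => pqvi.
by rewrite mulrBl; lra.
Qed.

(** A form that vanishes identically vanishes at each coordinate of the lifted
    points, which is a linear relation between their differences. *)
Lemma edge_form_neq0 (p q : 'I_n -> X) a b r :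
  support_point a != support_point b ->
  row_free (\matrix_i (lift_point r (p i) - lift_point r (q i))) ->
  edge_form p q a b != 0.
Proof.
rewrite -subr_eq0 => ab free; apply/eqP => form0.
have := row_relation_neq0 (\matrix_i (support_point (p i) - support_point (q i))) ab.
rewrite -/(edge_relation p q a b) -(mulmx_free_eq0 _ free) => /eqP; apply.
apply/rowP => k; rewrite mulmx_sum_row summxE mxE.
have := edge_form_eval p q a b (fun s => lift_point r s 0 k).
rewrite form0 meval0 => sum0; rewrite [RHS]sum0; apply: eq_bigr => i _.
by rewrite rowK !mxE.
Qed.

End Relations.

(** * The lifting and tropisms *)

Section Lifting.
Context {R : realType} {n : nat}.
Variables (A : 'I_n -> {fset 'rV[int]_n}) (c : 'I_n -> 'I_n).
Implicit Types (v : 'rV[R]_(1 + n)) (r : 'I_n * 'rV[int]_n -> R).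

Lemma lift_index i a : a \in A i ->
  exists2 s : lift_indices c A, (val s).1 = c i & (val s).2 = a.
Proof.
move=> aA; have sX : (c i, a) \in lift_indices c A.
  by apply/bigfcupP; exists i; rewrite ?mem_index_enum //; apply/imfsetP; exists a.
by exists [` sX]%fset.
Qed.

Lemma lift_support_index r i x :
  x \in lift_support (fun a => r (c i, a)) (A i) ->
  exists s : lift_indices c A, x = lift_point r s.
Proof.
move=> /imfsetP[a aA ->]; have [s s1 s2] := lift_index aA.
by exists s; rewrite /lift_point s1 s2.
Qed.

Lemma newton_polytope_index i x :
  x \in [fset map_mx intr a | a : 'rV[int]_n in A i]%fset ->
  exists s : lift_indices c A, x = support_point s :> 'rV[R]_n.
Proof.
move=> /imfsetP[a aA ->]; have [s _ s2] := lift_index aA.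
by exists s; rewrite /support_point s2.
Qed.

(** Distinct lifted points lie above distinct points of the support, and [v] has
    the same values on them as [x_part v] below; hence the face below has two
    vertices. *)
Lemma horizontal_edge_tropism (h : 'rV[int]_n -> R) v (B : {fset 'rV[int]_n}) E :
  z_part v = 0 -> has_dim E 1 ->
  (E `<=` face v (conv (lift_support h B)))%classic ->
  exists E', edge (newton_polytope B) E' /\
    (E' `<=` face (x_part v) (newton_polytope B))%classic.
Proof.
move=> vz /has_dim1_points[x [y [Ex Ey xy]]] Ev.
have [p [q [pX qX pq Fp Fq]]] := face_two_vertices (Ev _ Ex) (Ev _ Ey) xy.
have /imfsetP[a /= aB pE] := pX; have /imfsetP[b /= bB qE] := qX.
have inN d : d \in B -> map_mx intr d \in [fset map_mx intr a | a : 'rV[int]_n in B]%fset.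
  by move=> dB; apply/imfsetP; exists d.
have faceN d : d \in B -> face v (conv (lift_support h B)) (tau h d) ->
    face (x_part v) (newton_polytope B) (map_mx intr d : 'rV[R]_n).
  move=> dB [_ dmin]; apply/face_convP; first exact: inN.
  move=> _ /imfsetP[d' /= d'B ->].
  have := dmin _ (sub_conv (_ : tau h d' \in lift_support h B)).
  by rewrite !dot_tau vz !mulr0 !add0r; apply; apply/imfsetP; exists d'.
apply: (@face_contains_edge _ _ _ _ (map_mx intr a) (map_mx intr b)).
- exact: inN.
- exact: inN.
- apply: contra_neq pq => ab; rewrite pE qE; congr tau.
  apply/rowP => j; apply: (@intr_inj R).
  by have /rowP/(_ j) := ab; rewrite !mxE.
- by apply: faceN; rewrite // -pE.
- by apply: faceN; rewrite // -qE.
Qed.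

End Lifting.

Theorem proposition6p1 (R : realType) (n : nat) (n_gt0 : (0 < n)%N)
    (A : 'I_n -> {fset 'rV[int]_n}) (c : 'I_n -> 'I_n) :
  generically (lift_indices c A) (fun r : 'I_n * 'rV[int]_n -> R =>
    let Q i := conv (lift_support (fun a => r (c i, a)) (A i)) in
    forall F : set 'rV[R]_(1 + n), mixed_cells Q F ->
    forall v : 'rV[R]_(1 + n), lower_normal (minkowski_sum Q) F v ->
      (tropism A (x_part v) <-> z_part v = 0)).
Proof.
pose S := lift_indices c A.
pose L (k : {ffun 'I_n -> S} * {ffun 'I_n -> S} * (S * S)) :
  {mpoly R[#|{: S}|]} := edge_form k.1.1 k.1.2 k.2.1 k.2.2.
apply: (@generically_finite _ _ _ _ L) => r rgen Q F.
move=> [[Fdim _] [E [Eedge FE]]] v [_ Fv].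
have EQ i : (E i `<=` face v (Q i))%classic.
  apply: minkowski_summand_face; last by rewrite -FE.
    by move=> j; have [_ [w ->]] := Eedge j; move=> x [].
  by move=> j; have [[x [? [_ Ex _ _]]] _] := Eedge j; exists x.
split=> [trop|vz i]; last exact: horizontal_edge_tropism vz (Eedge i).1 (EQ i).
apply: contrapT => /eqP vz.
have [E0 [[/has_dim1_points[x [y [Ex Ey xy]]] _] E0v]] := trop (Ordinal n_gt0).
have [_ [_ [/(newton_polytope_index c)[a ->] /(newton_polytope_index c)[b ->] ab Fa Fb]]] :=
  face_two_vertices (E0v _ Ex) (E0v _ Ey) xy.
rewrite FE in Fdim; have [p [q [pqE free]]] := mixed_cell_edge_directions Eedge Fdim.
have index i z : z \in lift_support (fun a => r (c i, a)) (A i) ->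
    exists s : S, z = lift_point r s by exact: lift_support_index.
have /boolp.choice[ps psE] i : exists s : S, p i = lift_point r s.
  by have [/index] := pqE i.
have /boolp.choice[qs qsE] i : exists s : S, q i = lift_point r s.
  by have [_ /index] := pqE i.
have : L (finfun ps, finfun qs, (a, b)) != 0.
  apply: (@edge_form_neq0 _ _ _ _ _ _ _ r ab).
  rewrite (_ : \matrix_i _ = \matrix_i (p i - q i)) //.
  by apply/row_matrixP => i; rewrite !rowK /= !ffunE -psE -qsE.
apply/negP; rewrite negbK; apply/eqP/rgen.
apply: edge_form_eq0 vz _ (face_conv_eq Fa Fb) => i /=.
rewrite !ffunE -psE -qsE; have [_ _ /EQ Fp /EQ Fq] := pqE i.
exact: face_conv_eq Fp Fq.
Qed.
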